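(* Let $n\ge 1$ be an integer and $A,B\in\mathbb{N}$. Put $\bar A=A\bmod n$, $\bar B=B\bmod n$, $m=n^3\mathbin{\dot{-}}\bar B$, \[ w=n+12,\qquad T=n^2+n+1,\qquad q=2^{2w}, \] and for $i,j,k\ge 0$ write \[ S(i,j,k)=G_i(q,\,n-1)\;G_j(q^{\,n},\,n-1)\;G_k(q^{\,n^2},\,T-1). \] Define the two natural numbers \begin{align*} S_E^+ ={}& S(0,4,0)+m^2S(0,0,0)+S(6,0,0)+\bar A^2S(2,0,0)+n^2S(0,0,2)\\ &+2m\,S(0,2,0)+2\bar A\,S(4,0,0)+2n\,S(3,0,1)+2\bar A n\,S(1,0,1),\\ S_E^- ={}& 2\,S(3,2,0)+2\bar A\,S(1,2,0)+2n\,S(0,2,1)\\ &+2m\,S(3,0,0)+2\bar A m\,S(1,0,0)+2mn\,S(0,0,1), \end{align*} and \[ M=\bigl(2^w\mathbin{\dot{-}}1\bigr)\Bigl(\bigl(2^w+1\bigr)S(0,0,0)+S_E^-\;\mathbin{\dot{-}}\;S_E^+\Bigr). \] Then the number $N$ of points $(x,y)\in(\mathbb{Z}/n\mathbb{Z})^2$ with $y^2=x^3+Ax+B$ equals \[ N=\frac{\operatorname{HW}(M)}{w}\;\mathbin{\dot{-}}\;n^2T . \]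
   Context: $\mathbb{N}$ is the set of natural numbers including $0$. Truncated subtraction is $x\mathbin{\dot{-}}y=\max(x-y,0)$; in the definition of $M$ the truncated subtraction inside the large parentheses is applied to the whole sum $(2^w+1)S(0,0,0)+S_E^-$ and $S_E^+$. $a\bmod n$ is the least nonnegative residue. $\operatorname{HW}(M)$ is the number of ones in the binary representation of $M$. The generalized geometric progression is $G_r(q,t)=\sum_{j=0}^{t}j^r q^j$ for $q>1$, $t\ge 0$, $r\ge 0$, with the convention $0^0=1$. *)

(* Defs.v *)
From mathcomp Require Import all_boot.

Set Implicit Arguments.
Unset Strict Implicit.
Unset Printing Implicit Defensive.

(* Natural-number arithmetic of MathComp throughout: [m - n] is truncated
   subtraction, [%%] is the least nonnegative residue and [0 ^ 0 = 1]. *)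

(* The upper bound loses no bit, since M < 2 ^ M. *)
Definition HW (M : nat) : nat := \sum_(i < M) odd (M %/ 2 ^ i).

Definition G (r q t : nat) : nat := \sum_(j < t.+1) j ^ r * q ^ j.

Definition width (n : nat) : nat := n + 12.

Definition T (n : nat) : nat := n ^ 2 + n + 1.

Definition base (n : nat) : nat := 2 ^ (2 * width n).

Definition Sprod (n i j k : nat) : nat :=
  G i (base n) (n - 1) * G j (base n ^ n) (n - 1)
    * G k (base n ^ (n ^ 2)) (T n - 1).

Definition SEplus (n A B : nat) : nat :=
  let a := A %% n in
  let m := n ^ 3 - B %% n in
  let s := Sprod n in
  s 0 4 0 + m ^ 2 * s 0 0 0 + s 6 0 0 + a ^ 2 * s 2 0 0 + n ^ 2 * s 0 0 2
  + 2 * m * s 0 2 0 + 2 * a * s 4 0 0 + 2 * n * s 3 0 1 + 2 * a * n * s 1 0 1.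

Definition SEminus (n A B : nat) : nat :=
  let a := A %% n in
  let m := n ^ 3 - B %% n in
  let s := Sprod n in
  2 * s 3 2 0 + 2 * a * s 1 2 0 + 2 * n * s 0 2 1
  + 2 * m * s 3 0 0 + 2 * a * m * s 1 0 0 + 2 * m * n * s 0 0 1.

Definition Mterm (n A B : nat) : nat :=
  (2 ^ width n - 1)
  * ((2 ^ width n + 1) * Sprod n 0 0 0 + SEminus n A B - SEplus n A B).

(* Z/nZ is represented by its canonical residues 'I_n, which is right also for
   n = 1, whereas 'Z_1 is Z/2Z. *)
Definition points (n A B : nat) : {set 'I_n * 'I_n} :=
  [set p : 'I_n * 'I_n | p.2 ^ 2 == p.1 ^ 3 + A * p.1 + B %[mod n]].

(* Main.v *)
(* Put u = y^2 + m and v = x^3 + ax + nz, so that the nine terms of S_E^+ and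
   the six of S_E^- encode u^2 + v^2 and 2uv.  In base q = 2^(2w) the second
   factor of M has the digit 2^w + 1 - (u - v)^2 at position x + n y + n^2 z.
   This digit is 2^w + 1 if u = v, and lies in [1, 2^w] otherwise, because w is
   large enough for (u - v)^2 <= 2^w.  Multiplied by 2^w - 1 it still fits in
   2w bits; it has Hamming weight 2w if u = v, and otherwise exactly w, since
   (c + 1)(2^w - 1) = c 2^w + (2^w - 1 - c) juxtaposes c and its complement.
   So HW(M) = w (n^2 T + #{u = v}), and (x, y) is on the curve if and only if
   u = v for a (unique) z < T. *)
Require Import Defs.
From mathcomp Require Import all_boot zify ring.

Set Implicit Arguments.
Unset Strict Implicit.
Unset Printing Implicit Defensive.

(** * Hamming weight: concatenation, complement, Mersenne multiples *)

Definition bitcount k M := \sum_(i < k) odd (M %/ 2 ^ i).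

Lemma bitcount_widen k l M : M < 2 ^ k -> k <= l -> bitcount l M = bitcount k M.
Proof.
move=> ltM lekl; rewrite /bitcount -(subnKC lekl) big_split_ord /=.
rewrite [X in _ + X]big1 ?addn0 // => i _.
rewrite divn_small //; apply: leq_trans ltM _.
by rewrite leq_exp2l // leq_addr.
Qed.

(** The range of [HW] varies with its argument; a common window lets weights be split and added bit
    by bit. *)
Lemma HW_bitcount k M : M < 2 ^ k -> HW M = bitcount k M.
Proof.
move=> ltM; have [lekM|ltMk] := leqP k M; first exact: bitcount_widen.
by rewrite (bitcount_widen (ltn_expl M (isT : 1 < 2)) (ltnW ltMk)).
Qed.

Lemma odd_div_lo k i lo hi : i < k ->
  odd ((hi * 2 ^ k + lo) %/ 2 ^ i) = odd (lo %/ 2 ^ i).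
Proof.
move=> ltik; rewrite -(subnK ltik) -[(k - i.+1) + _]addSnnS expnD mulnA.
by rewrite divnMDl ?expn_gt0 // oddD expnS oddM oddM andbF.
Qed.

Lemma HW_cat k lo hi : lo < 2 ^ k -> HW (hi * 2 ^ k + lo) = HW hi + HW lo.
Proof.
move=> ltlo; have lthi := ltn_expl hi (isT : 1 < 2).
have lt : hi * 2 ^ k + lo < 2 ^ (k + hi).
  rewrite expnD mulnC; apply: (@leq_trans (2 ^ k * hi.+1)).
    by rewrite mulnS addnC ltn_add2r.
  by rewrite leq_pmul2l // expn_gt0.
rewrite (HW_bitcount lt) (HW_bitcount ltlo) (HW_bitcount lthi) /bitcount.
rewrite big_split_ord [RHS]addnC /=; congr (_ + _); apply: eq_bigr => i _.
  by rewrite odd_div_lo.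
by rewrite expnD divnMA divnMDl ?expn_gt0 // (divn_small ltlo) addn0.
Qed.

(** The size bound is carried through the induction because [HW_cat] needs it, and it makes the
    whole sum usable as one digit of a larger base. *)
Lemma HW_digits s L (d : nat -> nat) : (forall i, i < L -> d i < 2 ^ s) ->
  \sum_(i < L) d i * (2 ^ s) ^ i < (2 ^ s) ^ L /\
  HW (\sum_(i < L) d i * (2 ^ s) ^ i) = \sum_(i < L) HW (d i).
Proof.
elim: L => [|L IH] ltd; first by rewrite !big_ord0 /HW big_ord0.
have [lt eqHW] := IH (fun i lti => ltd i (leqW lti)).
rewrite !big_ord_recr /= addnC; split.
  apply: (@leq_trans ((d L).+1 * (2 ^ s) ^ L)).
    by rewrite mulSn addnC ltn_add2r.
  by rewrite expnS leq_mul2r ltd ?orbT.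
by rewrite -expnM HW_cat ?expnM // eqHW addnC.
Qed.

Lemma odd_div_compl w c i : c < 2 ^ w -> i < w ->
  odd ((2 ^ w - 1 - c) %/ 2 ^ i) = ~~ odd (c %/ 2 ^ i).
Proof.
move=> ltc ltiw.
have p_gt0 : 0 < 2 ^ i by rewrite expn_gt0.
have ltr := ltn_pmod c p_gt0.
have eqw : 2 ^ w = 2 * 2 ^ (w - i.+1) * 2 ^ i.
  by rewrite -expnS -expnD addSnnS subnK.
have ltq : c %/ 2 ^ i < 2 * 2 ^ (w - i.+1) by rewrite ltn_divLR // -eqw.
(* No borrow occurs: quotient and remainder modulo [2 ^ i] are complemented separately. The parity
   flips because [2 ^ w / 2 ^ i] is even. *)
have -> : 2 ^ w - 1 - c =
    (2 * 2 ^ (w - i.+1) - 1 - c %/ 2 ^ i) * 2 ^ i + (2 ^ i - 1 - c %% 2 ^ i).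
  rewrite {1}(divn_eq c (2 ^ i)) eqw; move: ltr ltq; rewrite {eqw}.
  move: (c %/ _) (c %% _) => a b; move: (2 * _) (2 ^ i) => e p ltb lta.
  have -> : e = a + 1 + (e - a - 1) by lia.
  by rewrite !mulnBl !mulnDl; nia.
rewrite divnMDl // [X in _ + X]divn_small ?addn0; last by lia.
rewrite -subnDA oddB; last by lia.
by rewrite oddM oddD.
Qed.

Lemma HW_compl w c : c < 2 ^ w -> HW c + HW (2 ^ w - 1 - c) = w.
Proof.
move=> ltc; have w_gt0 : 0 < 2 ^ w by rewrite expn_gt0.
rewrite (HW_bitcount ltc) (@HW_bitcount w) /bitcount; last by lia.
rewrite -big_split /= -[RHS]card_ord -sum1_card; apply: eq_bigr => i _.
by rewrite odd_div_compl //; case: odd.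
Qed.

Lemma HW_mersenne w : HW (2 ^ w - 1) = w.
Proof.
rewrite -[RHS](@HW_compl w 0) ?expn_gt0 // subn0.
by rewrite [X in X + _]/HW big_ord0.
Qed.

Lemma HW_mersenneM w c : c < 2 ^ w -> HW ((2 ^ w - 1) * c.+1) = w.
Proof.
move=> ltc; rewrite -[RHS](HW_compl ltc) -(@HW_cat w); last by lia.
by congr HW; nia.
Qed.

Lemma HW_mersenne_sq w : HW ((2 ^ w - 1) * (2 ^ w + 1)) = w + w.
Proof.
rewrite -{3 4}(HW_mersenne w) -(@HW_cat w); last by have := expn_gt0 2 w; lia.
by congr HW; nia.
Qed.

(** * Triple sums as nested digit expansions *)

Definition gsum (n t q : nat) (f : nat -> nat -> nat -> nat) :=
  \sum_(z < t) (\sum_(y < n) (\sum_(x < n) f x y z * q ^ x) * (q ^ n) ^ y)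
    * (q ^ (n ^ 2)) ^ z.

Lemma gsumD n t q f g :
  gsum n t q f + gsum n t q g = gsum n t q (fun x y z => f x y z + g x y z).
Proof.
rewrite /gsum -big_split; apply: eq_bigr => z _ /=; rewrite -mulnDl.
congr (_ * _); rewrite -big_split; apply: eq_bigr => y _ /=; rewrite -mulnDl.
by congr (_ * _); rewrite -big_split; apply: eq_bigr => x _ /=; rewrite -mulnDl.
Qed.

Lemma gsumZ n t q c f : c * gsum n t q f = gsum n t q (fun x y z => c * f x y z).
Proof.
rewrite /gsum big_distrr; apply: eq_bigr => z _ /=; rewrite mulnA.
congr (_ * _); rewrite big_distrr; apply: eq_bigr => y _ /=; rewrite mulnA.
by congr (_ * _); rewrite big_distrr; apply: eq_bigr => x _ /=; rewrite mulnA.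
Qed.

Lemma eq_gsum n t q f g :
    (forall x y z, x < n -> y < n -> z < t -> f x y z = g x y z) ->
  gsum n t q f = gsum n t q g.
Proof.
move=> eqfg; apply: eq_bigr => z _; congr (_ * _).
apply: eq_bigr => y _; congr (_ * _).
by apply: eq_bigr => x _; rewrite eqfg.
Qed.

Lemma Sprod_gsum n i j k : 0 < n ->
  Sprod n i j k = gsum n (T n) (base n) (fun x y z => x ^ i * y ^ j * z ^ k).
Proof.
move=> n_gt0; rewrite /Sprod /G /gsum !subn1 !prednK //; last by rewrite /T addn1.
rewrite big_distrr; apply: eq_bigr => z _ /=; rewrite mulnA; congr (_ * _).
rewrite big_distrr big_distrl; apply: eq_bigr => y _ /=.
rewrite mulnA mulnAC; congr (_ * _).
rewrite !big_distrl; apply: eq_bigr => x _ /=.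
by rewrite -!mulnA; congr (_ * _); rewrite mulnC -mulnA.
Qed.

(** [HW_digits] applies once per level: a row over [x] is a digit in base [2 ^ (s * n)], a layer
    over [y] one in base [2 ^ (s * n * n)]. *)
Lemma HW_gsum s n t f :
    (forall x y z, x < n -> y < n -> z < t -> f x y z < 2 ^ s) ->
  HW (gsum n t (2 ^ s) f) = \sum_(z < t) \sum_(y < n) \sum_(x < n) HW (f x y z).
Proof.
move=> ltf.
have px y z (lty : y < n) (ltz : z < t) :=
  HW_digits (fun x ltx => ltf x y z ltx lty ltz).
have py z (ltz : z < t) : _ /\ _ := @HW_digits (s * n) n
  (fun y => \sum_(x < n) f x y z * (2 ^ s) ^ x)
  (fun y lty => eq_rect_r (leq _) (proj1 (px y z lty ltz)) (expnM 2 s n)).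
have [|_] := @HW_digits (s * n * n) t
  (fun z => \sum_(y < n) (\sum_(x < n) f x y z * (2 ^ s) ^ x)
              * (2 ^ (s * n)) ^ y).
  by move=> z ltz; rewrite (expnM 2 (s * n)); exact: (proj1 (py z ltz)).
rewrite /gsum -!expnM -mulnn mulnA => ->.
apply: eq_bigr => z _; rewrite (proj2 (py z (ltn_ord z))).
by apply: eq_bigr => y _; rewrite (proj2 (px y z _ _)).
Qed.

(** * Size estimates and the curve congruence *)

Lemma sixth_power_bound n : (n ^ 3 + n ^ 2) ^ 2 <= 2 ^ (n + 12).
Proof.
rewrite expnD; have [le9n|] := leqP 9 n.
  rewrite -(subnK le9n); elim: (n - 9) => [|k IH]; first by lia.
  rewrite addSn (expnS 2 (k + 9)) -mulnA; apply: leq_trans (leq_mul (leqnn 2) IH).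
  (* With [n = k + 9], doubling the right side suffices once [((n + 1) * (n + 2)) ^ 2 <= 2 * n ^ 4];
     the common factor [(n + 1) ^ 2] is kept on both sides. *)
  have : (k + 10) ^ 2 * ((k + 10) * (k + 11)) ^ 2
         <= (k + 10) ^ 2 * (2 * (k + 9) ^ 4).
    by rewrite leq_mul2l; apply/orP; right; nia.
  by lia.
by do 9! [case: n => [|n]; first by lia].
Qed.

(** The only candidate for [z] is [(u - v) / n], and the last bound puts it in range. *)
Lemma sum_eq_affine n t u v : 0 < n -> v <= u -> u - v < n * t ->
  \sum_(z < t) (u == v + n * z) = (n %| u - v).
Proof.
move=> n_gt0 levu lt; have [/dvdnP[z0 eqz]|ndv] := boolP (n %| u - v).
  have ltz0 : z0 < t by move: lt; rewrite eqz mulnC ltn_pmul2l.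
  rewrite (bigD1 (Ordinal ltz0)) //= big1 => [|z nez].
    by case: eqP => //; lia.
  case: eqP => // equ; case/eqP: nez; apply: val_inj => /=.
  have /eqP : n * z = n * z0 by lia.
  by rewrite eqn_pmul2l // => /eqP.
rewrite big1 // => z _; case: eqP => // equ.
by case/negP: ndv; rewrite equ addKn dvdn_mulr.
Qed.

(** For positive [n] this is [y ^ 2 - B] modulo [n], shifted by a multiple of [n] large enough to
    dominate [rhs]. *)
Definition lhs n B y := y ^ 2 + (n ^ 3 - B %% n).

Definition rhs n A x := x ^ 3 + A %% n * x.

Lemma lhs_bound n B y : y < n -> lhs n B y <= n ^ 3 + n ^ 2.
Proof.
move=> /ltnW leyn; have : y ^ 2 <= n ^ 2 by rewrite leq_exp2r.
by rewrite /lhs; lia.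
Qed.

(** The slack [n] absorbs the [B %% n] subtracted in [lhs]. *)
Lemma rhs_bound n A x : x < n -> rhs n A x + n <= n ^ 3.
Proof.
case: n => // n ltx; rewrite /rhs; have := ltn_pmod A (ltn0Sn n).
move: (A %% _) => a lta.
have : x ^ 3 <= n ^ 3 by rewrite leq_exp2r.
have : a * x <= n * n by apply: leq_mul.
by nia.
Qed.

Lemma rhs_le_lhs n A B x y : x < n -> rhs n A x <= lhs n B y.
Proof.
move=> ltx; have := rhs_bound A ltx; rewrite /lhs.
have : B %% n < n by apply: ltn_pmod; case: n ltx.
by lia.
Qed.

Lemma dvdn_lhsBrhs n A B x y : x < n ->
  (n %| lhs n B y - rhs n A x) = (y ^ 2 == x ^ 3 + A * x + B %[mod n]).
Proof.
(* Adding [B %% n] to both sides turns the shift into [n ^ 3], which vanishes modulo [n]. *)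
move=> ltx; rewrite -eqn_mod_dvd ?rhs_le_lhs // -(eqn_modDr (B %% n)) /lhs.
have n_gt0 : 0 < n by case: n ltx.
have leb : B %% n <= n ^ 3.
  by apply: leq_trans (ltnW (ltn_pmod B n_gt0)) _; rewrite -{1}(expn1 n) leq_pexp2l.
rewrite -addnA subnK // [y ^ 2 + _]addnC (expnS n 2) [n * _]mulnC modnMDl modnDmr.
by rewrite /rhs -!addnA !(addnCA (x ^ 3)) -modnDml modnMml modnDml.
Qed.

(** This is [(u - v) ^ 2 <= 2 ^ w] free of subtraction, since either of [u], [v] may be larger; both
    gaps are at most [n ^ 3 + n ^ 2]. *)
Lemma sqr_dist_bound n A B x y z : x < n -> y < n -> z < T n ->
  let u := lhs n B y in let v := rhs n A x + n * z in
  u ^ 2 + v ^ 2 <= 2 ^ width n + 2 * (u * v).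
Proof.
move=> ltx lty ltz; set u := lhs _ _ _; set v := _ + _; rewrite /=.
have leu : u <= n ^ 3 + n ^ 2 := lhs_bound B lty.
have lev : v <= u + (n ^ 3 + n ^ 2).
  have : n * z <= n ^ 3 + n ^ 2.
    apply: (@leq_trans (n * (n ^ 2 + n))); last by rewrite mulnDr -expnS mulnn.
    by rewrite leq_mul2l; move: ltz; rewrite /T addn1 ltnS => ->; rewrite orbT.
  by have := rhs_le_lhs A B y ltx; rewrite -/u /v; lia.
apply: leq_trans (leq_add (sixth_power_bound n) (leqnn _)).
by move: (n ^ 3 + n ^ 2) leu lev => b; nia.
Qed.

(** * The digits of [Mterm] and the point count *)

Definition digit n A B x y z :=
  let u := lhs n B y in let v := rhs n A x + n * z in
  2 ^ width n + 1 + 2 * (u * v) - (u ^ 2 + v ^ 2).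

Lemma Mterm_gsum n A B : 0 < n ->
  Mterm n A B = (2 ^ width n - 1) * gsum n (T n) (base n) (digit n A B).
Proof.
move=> n_gt0; rewrite /Mterm /SEminus /SEplus; congr (_ * _).
rewrite !Sprod_gsum // !gsumZ !gsumD.
(* [P] collects the coefficients of [SEplus], [Q] the rest. As [P <= Q] at each position, the
   truncated subtraction of the sums acts digit by digit. *)
set P := (X in _ - gsum _ _ _ X); set Q := (X in gsum _ _ _ X - _).
rewrite (_ : gsum _ _ _ Q = gsum n (T n) (base n) (digit n A B) + gsum n (T n) (base n) P).
  by rewrite addnK.
rewrite gsumD; apply: eq_gsum => x y z ltx lty ltz.
have /= := sqr_dist_bound A B ltx lty ltz.
rewrite /digit /lhs /rhs => le.
rewrite (_ : P x y z = (y ^ 2 + (n ^ 3 - B %% n)) ^ 2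
                       + (x ^ 3 + A %% n * x + n * z) ^ 2); last first.
  by rewrite /P; move: (n ^ 3 - _) (A %% n) => m a; ring.
rewrite subnK; last by apply: leq_trans le _; rewrite leq_add2r leq_addr.
by rewrite /Q; move: (n ^ 3 - _) (A %% n) (2 ^ _) => m a p; ring.
Qed.

Lemma digit_HW n A B x y z : x < n -> y < n -> z < T n ->
  (2 ^ width n - 1) * digit n A B x y z < base n /\
  HW ((2 ^ width n - 1) * digit n A B x y z)
    = width n * (1 + (lhs n B y == rhs n A x + n * z)).
Proof.
move=> ltx lty ltz; have /= := sqr_dist_bound A B ltx lty ltz.
have -> : base n = 2 ^ width n * 2 ^ width n by rewrite -expnD addnn -mul2n.
rewrite /digit.
move: (lhs _ _ _) (rhs _ _ _ + _) => u v le.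
have p_gt0 : 0 < 2 ^ width n by rewrite expn_gt0.
have [<-|neuv] := eqVneq u v.
  rewrite (mulnn u) (addnn (u ^ 2)) -mul2n addnK.
  by rewrite HW_mersenne_sq muln2 addnn; split=> //; nia.
(* Strictness for [u != v] lowers the digit to at most [2 ^ w], so its predecessor [c] fits in [w]
   bits. *)
have lt : 2 * (u * v) < u ^ 2 + v ^ 2 by rewrite ltn_neqAle !nat_Cauchy neuv.
have [c -> ltc] : exists2 c,
    2 ^ width n + 1 + 2 * (u * v) - (u ^ 2 + v ^ 2) = c.+1 & c < 2 ^ width n.
  by exists (2 ^ width n + 2 * (u * v) - (u ^ 2 + v ^ 2)); lia.
by rewrite HW_mersenneM // addn0 muln1; split=> //; nia.
Qed.

Lemma card_points n A B : 0 < n ->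
  \sum_(z < T n) \sum_(y < n) \sum_(x < n) (lhs n B y == rhs n A x + n * z)
    = #|points n A B|.
Proof.
move=> n_gt0; rewrite -sum1_card exchange_big /=.
under eq_bigr do rewrite exchange_big.
rewrite exchange_big pair_big /= [RHS]big_mkcond; apply: eq_bigr => -[x y] _ /=.
rewrite inE /= sum_eq_affine ?rhs_le_lhs ?dvdn_lhsBrhs //.
(* [n * T n = n ^ 3 + n ^ 2 + n] exceeds every [lhs], so no solution [z] is missed. *)
have := lhs_bound B (ltn_ord y); rewrite /T; nia.
Qed.

Theorem theorem1 (n A B : nat) (hn : 1 <= n) :
  width n %| HW (Mterm n A B) /\
  #|points n A B| = HW (Mterm n A B) %/ width n - n ^ 2 * T n.
Proof.
have eqHW : HW (Mterm n A B) = width n * (n ^ 2 * T n + #|points n A B|).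
  (* The factor [2 ^ w - 1] is moved into the digits first; they stay below the base, so no carry
     mixes their weights. *)
  rewrite Mterm_gsum // gsumZ HW_gsum => [|x y z ltx lty ltz]; last first.
    exact: (digit_HW A B ltx lty ltz).1.
  rewrite -card_points //.
  under eq_bigr => z _ do under eq_bigr => y _ do under eq_bigr => x _ do
    rewrite (digit_HW A B (ltn_ord x) (ltn_ord y) (ltn_ord z)).2.
  under eq_bigr => z _ do under eq_bigr => y _ do
    rewrite -big_distrr big_split sum1_card card_ord.
  under eq_bigr => z _ do rewrite -big_distrr big_split sum_nat_const card_ord.
  rewrite -big_distrr big_split /= sum_nat_const card_ord.
  by rewrite mulnn [T n * _]mulnC.
by rewrite eqHW dvdn_mulr // mulKn ?addKn // /width addnS.
Qed.
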